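(* Let $P$ be a probability measure on $\mathbb{R}^p$ that is absolutely continuous with respect to the Lebesgue measure, with density $f$. Suppose that $f$ is twice continuously differentiable in $\mathbb{R}^p$ and that for all $\alpha>0$ the set $R^\alpha=\{x\in\mathbb{R}^p:f(x)\ge\alpha\}$ is compact. Then, for all $t\ge 0$ and all $x\in S=\{y\in\mathbb{R}^p:f(y)>0\}$, $$\lim_{\tau\to 0^+}u_{x,\tau}(t)=u_x(t).$$
   Context: $p\ge 1$; $\|\cdot\|$ is the Euclidean norm on $\mathbb{R}^p$. For $x\in\mathbb{R}^p$ and $\tau\in[0,\infty]$, $$Z_\tau(x)=\{(x_1,x_2)\in\mathbb{R}^p\times\mathbb{R}^p:\ \max_{i=1,2}\|x-x_i\|\le\|x_1-x_2\|\le\tau\}.$$ The local lens depth is $LLD(x,\tau)=\int_{\mathbb{R}^p\times\mathbb{R}^p}\mathbf{I}((x_1,x_2)\in Z_\tau(x))\,dP(x_1)\,dP(x_2)$. $\Lambda_1$ is the Lebesgue measure of $Z_1(0)$ in $\mathbb{R}^p\times\mathbb{R}^p$. For $0<\tau<\infty$, $f_\tau(x)=\frac{1}{\tau^p\sqrt{\Lambda_1}}\sqrt{LLD(x,\tau)}$ and $S_\tau=\{x\in\mathbb{R}^p:f_\tau(x)>0\}$. $u_x(t)$ is the solution at time $t$ of the gradient system $u'(t)=\nabla f(u(t))$ (in $S$) with $u_x(0)=x$, and $u_{x,\tau}(t)$ is the solution at time $t$ of the gradient system $u'(t)=\nabla f_\tau(u(t))$ (in $S_\tau$) with $u_{x,\tau}(0)=x$.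 Under the stated hypotheses, for every $x\in S$ (one has $S\subset S_\tau$) these solutions exist, are unique, and are defined for all $t\ge 0$. *)

(* Defs.v *)
From HB Require Import structures.
From mathcomp Require Import all_boot all_order all_algebra.
From mathcomp Require Import all_classical all_reals all_analysis.

Set Implicit Arguments.
Unset Strict Implicit.
Unset Printing Implicit Defensive.

Import Order.TTheory GRing.Theory Num.Theory.
Import numFieldNormedType.Exports.

Local Open Scope classical_set_scope.
Local Open Scope ring_scope.

(* Vectors of R^n are row vectors ['rV[R]_n].  Their sigma-algebra is the one
   generated by the coordinates (the product sigma-algebra, i.e. the Borel sets
   of R^n), as for [n.-tuple]. *)
Definition measure_rV_display : measure_display -> measure_display.
Proof. exact. Qed.

Section measurable_rV.
Context (R : realType) (n : nat).

Let coord (i : 'I_n) (v : 'rV[R]_n) : R := v ord0 i.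

Let rV_set0 : g_sigma_preimage coord set0.
Proof. exact: sigma_algebra0. Qed.

Let rV_setC A : g_sigma_preimage coord A -> g_sigma_preimage coord (~` A).
Proof. exact: sigma_algebraC. Qed.

Let rV_bigcup (F : _^nat) : (forall i, g_sigma_preimage coord (F i)) ->
  g_sigma_preimage coord (\bigcup_i (F i)).
Proof. exact: sigma_algebra_bigcup. Qed.

HB.instance Definition _ :=
  @isMeasurable.Build (measure_rV_display default_measure_display)
    'rV[R]_n (g_sigma_preimage coord) rV_set0 rV_setC rV_bigcup.

Lemma measurable_rV_coord (i : 'I_n) :
  measurable_fun [set: 'rV[R]_n] (fun v : 'rV[R]_n => v ord0 i).
Proof.
move=> _ Y mY; rewrite setTI; apply: sub_sigma_algebra => /=.
rewrite -bigcup_seq/=; exists i => /=; first by rewrite mem_index_enum.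
by exists Y => //; rewrite setTI.
Qed.

Lemma measurable_fun_rV d (T : measurableType d) (g : T -> 'rV[R]_n) :
  (forall i, measurable_fun setT (fun t => g t ord0 i)) ->
  measurable_fun [set: T] g.
Proof.
move=> mg _ Y; rewrite setTI => mY.
suff : measurable `<=` image_set_system setT g (@measurable _ T).
  by move=> /(_ _ mY); rewrite /image_set_system/= setTI.
apply: smallest_sub.
  exact/sigma_algebra_image/sigma_algebra_measurable.
rewrite -bigcup_seq => _ [i _ [A mA <-]].
rewrite /image_set_system/= !setTI.
by have := mg i measurableT _ mA; rewrite setTI.
Qed.

End measurable_rV.

(* Lebesgue measure on R^n, by recursion on n: R^(n+1) carries the image of
   the product measure on R x R^n under concatenation. *)
Definition rV_cons (R : realType) (n : nat) (z : R * 'rV[R]_n) : 'rV[R]_n.+1 :=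
  row_mx (z.1)%:M z.2.

Lemma rV_cons0 (R : realType) n (z : R * 'rV[R]_n) : rV_cons z ord0 ord0 = z.1.
Proof.
transitivity ((z.1)%:M (ord0 : 'I_1) (ord0 : 'I_1)); last first.
  by rewrite mxE eqxx.
rewrite -(row_mxEl ((z.1)%:M : 'M[R]_1) z.2).
by congr (row_mx _ _ _ _); exact/val_inj.
Qed.

Lemma rV_consS (R : realType) n (z : R * 'rV[R]_n) i :
  rV_cons z ord0 (lift ord0 i) = z.2 ord0 i.
Proof.
rewrite -[RHS](row_mxEr ((z.1)%:M : 'M[R]_1)).
by congr (row_mx _ _ _ _); exact/val_inj.
Qed.

Lemma measurable_rV_cons (R : realType) n :
  measurable_fun setT (@rV_cons R n).
Proof.
apply: measurable_fun_rV => i; case: (unliftP ord0 i) => [j ->|->].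
  rewrite (_ : (fun _ => _) = (fun v : 'rV[R]_n => v ord0 j) \o snd).
    exact: (measurableT_comp (@measurable_rV_coord R n j) measurable_snd).
  by apply/funext => z; rewrite rV_consS.
rewrite (_ : (fun _ => _) = fst); first exact: measurable_fst.
by apply/funext => z; rewrite rV_cons0.
Qed.

Section lebesgue_cons.
Context (R : realType) (n : nat).
Variable mu : {sigma_finite_measure set 'rV[R]_n -> \bar R}.
Local Open Scope ereal_scope.

Definition lebesgue_cons : set 'rV[R]_n.+1 -> \bar R :=
  pushforward (@lebesgue_measure R \x mu) (@rV_cons R n).

Let lebesgue_cons0 : lebesgue_cons set0 = 0.
Proof. by rewrite /lebesgue_cons /pushforward preimage_set0 measure0. Qed.

Let lebesgue_cons_ge0 A : 0 <= lebesgue_cons A.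
Proof. by rewrite /lebesgue_cons /pushforward; exact: measure_ge0. Qed.

Let lebesgue_cons_sigma_additive : semi_sigma_additive lebesgue_cons.
Proof.
move=> F mF tF mUF; rewrite /lebesgue_cons /pushforward preimage_bigcup.
have mpre A : measurable A -> measurable (@rV_cons R n @^-1` A).
  by move=> mA; rewrite -[X in measurable X]setTI; exact: measurable_rV_cons.
apply: measure_semi_sigma_additive.
- by move=> k; exact: mpre.
- apply/trivIsetP => /= i j _ _ ij; rewrite -preimage_setI.
  by move/trivIsetP : tF => /(_ _ _ _ _ ij) ->//; rewrite preimage_set0.
- by rewrite -preimage_bigcup; exact: mpre.
Qed.

HB.instance Definition _ := isMeasure.Build _ _ _ lebesgue_cons
  lebesgue_cons0 lebesgue_cons_ge0 lebesgue_cons_sigma_additive.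

Lemma lebesgue_consE (A : set R) (B : set 'rV[R]_n) :
  measurable A -> measurable B ->
  lebesgue_cons [set v | A (v ord0 ord0) /\ B (\row_i v ord0 (lift ord0 i))] =
  lebesgue_measure A * mu B.
Proof.
move=> mA mB; rewrite -product_measure1E// /lebesgue_cons /pushforward.
congr (product_measure1 _ _ _).
apply/seteqP; split => -[a b] /=; rewrite rV_cons0;
  by (have -> : \row_i rV_cons (a, b) ord0 (lift ord0 i) = b
      by apply/rowP => i; rewrite mxE rV_consS).
Qed.

Let lebesgue_cons_sigma_finite : sigma_finite setT lebesgue_cons.
Proof.
have /sigma_finiteP[F [TF ndF Foo]] := sigma_finiteT (@lebesgue_measure R).
have /sigma_finiteP[G [TG ndG Goo]] := sigma_finiteT mu.
pose tl (v : 'rV[R]_n.+1) : 'rV[R]_n := \row_i v ord0 (lift ord0 i).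
have mtl : measurable_fun setT tl.
  apply: measurable_fun_rV => i.
  rewrite (_ : (fun _ => _) = (fun v : 'rV[R]_n.+1 => v ord0 (lift ord0 i))).
    exact: measurable_rV_coord.
  by apply/funext => v; rewrite mxE.
exists (fun k => [set v : 'rV[R]_n.+1 | F k (v ord0 ord0) /\ G k (tl v)]).
  apply/esym; rewrite -subTset => v _.
  have [k _ Fk] : (\bigcup_k F k) (v ord0 ord0) by rewrite -TF.
  have [l _ Gl] : (\bigcup_k G k) (tl v) by rewrite -TG.
  exists (maxn k l) => //; split.
    by move: Fk; exact/subsetPset/ndF/leq_maxl.
  by move: Gl; exact/subsetPset/ndG/leq_maxr.
move=> k; have [mF Fk] := Foo k; have [mG Gk] := Goo k; split.
  apply: measurableI.
    by rewrite -[X in measurable X]setTI; exact: measurable_rV_coord.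
  by rewrite -[X in measurable X]setTI; exact: mtl.
by rewrite lebesgue_consE// lte_mul_pinfty// ge0_fin_numE.
Qed.

HB.instance Definition _ := Measure_isSigmaFinite.Build _ _ _ lebesgue_cons
  lebesgue_cons_sigma_finite.

End lebesgue_cons.

Fixpoint lebesgue_rV (R : realType) (n : nat) :
    {sigma_finite_measure set 'rV[R]_n -> \bar R} :=
  match n with
  | 0 => \d_(0 : 'rV[R]_0)
  | m.+1 => lebesgue_cons (lebesgue_rV R m)
  end.

Lemma lebesgue_rV_box (R : realType) (n : nat) (A : 'I_n -> set R) :
  (forall i, measurable (A i)) ->
  lebesgue_rV R n [set v | forall i, A i (v ord0 i)] =
  (\big[*%E/1]_(i < n) lebesgue_measure (A i))%E.
Proof.
elim: n A => [|n IH] A mA.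
  by rewrite big_ord0 /= diracE mem_set// => -[].
rewrite big_ord_recl -IH//= -lebesgue_consE//.
  congr (lebesgue_cons _ _); apply/seteqP; split => [v Av/=|v /= [A0 AS] i].
    by split => // i; rewrite mxE.
  by case: (unliftP ord0 i) => [j ->|->//]; have := AS j; rewrite mxE.
rewrite [X in measurable X](_ : _ = \bigcap_(i in [set: 'I_n])
    (fun v : 'rV[R]_n => v ord0 i) @^-1` A (lift ord0 i)).
  apply: fin_bigcap_measurable => // i _; rewrite -[X in measurable X]setTI.
  exact: measurable_rV_coord.
by apply/seteqP; split => v Av i; [move=> _; exact: Av|exact: (Av i I)].
Qed.

Section lens_depth.
Context (R : realType) (p : nat).
Implicit Types (x v : 'rV[R]_p) (f : 'rV[R]_p -> R) (P : probability 'rV[R]_p R).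

(* Euclidean norm; the library's [`|x|] on matrices is the sup norm. *)
Definition enorm x : R := Num.sqrt (\sum_(i < p) x ord0 i ^+ 2).

Definition Zset (tau : \bar R) x : set ('rV[R]_p * 'rV[R]_p) :=
  [set z | Num.max (enorm (x - z.1)) (enorm (x - z.2)) <= enorm (z.1 - z.2)
           /\ ((enorm (z.1 - z.2))%:E <= tau)%E].

Definition LLD P x (tau : \bar R) : \bar R :=
  (\int[P \x P]_z (\1_(Zset tau x) z)%:E)%E.

Definition Lambda1 : \bar R :=
  (lebesgue_rV R p \x lebesgue_rV R p)%E (Zset 1%E 0).

Definition f_tau P (tau : R) x : R :=
  (tau ^+ p * Num.sqrt (fine Lambda1))^-1 * Num.sqrt (fine (LLD P x tau%:E)).

Definition is_density P f :=
  [/\ measurable_fun setT f, (forall x, 0 <= f x) &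
      forall A, measurable A -> P A = (\int[lebesgue_rV R p]_(x in A) (f x)%:E)%E].

Definition pos_set f : set 'rV[R]_p := [set x | 0 < f x].

Definition partial f (i : 'I_p) : 'rV[R]_p -> R :=
  fun x => 'D_(delta_mx ord0 i) f x.

Definition grad f x : 'rV[R]_p := \row_i partial f i x.

Fixpoint Ck (k : nat) f : Prop :=
  continuous f /\
  if k is m.+1 then
    forall i, (forall x, derivable f x (delta_mx ord0 i)) /\ Ck m (partial f i)
  else True.

(* [u] solves u' = grad g (u) in [D] on [0, +oo[ with u(0) = x.  The values of
   [u] at negative times are irrelevant; where [grad g] is continuous on [D],
   continuity of [u] at 0 makes the equation hold there for the right
   derivative as well. *)
Definition gradient_solution g (D : set 'rV[R]_p) x (u : R -> 'rV[R]_p) :=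
  [/\ u 0 = x, (forall t : R, 0 <= t -> D (u t)),
      {within `[0, +oo[, continuous u} &
      forall t : R, 0 < t -> is_derive t 1 u (grad g (u t))].

End lens_depth.

(* Main.v *)
Require Import Defs.
From mathcomp Require Import all_boot all_order all_algebra.
From mathcomp Require Import all_classical all_reals all_analysis.
From mathcomp Require Import measurable_realfun lebesgue_integral_under ring lra.

(** The heart of the matter is that [f_tau] converges to [f] together with its
gradient, uniformly near any compact piece of the positivity set; the
convergence of the flows is then the stability of an ODE with Lipschitz
right-hand side under small perturbations.

Convergence of the fields.  Writing [P] through its density and substituting
[x1 = x + tau a], [x2 = x + tau b] turns the lens depth into [tau ^ (2p)] times
the integral of [f (x + tau a) f (x + tau b)] over [Z_1(0)] ([LLDE]).  The
normalization in [f_tau] is exactly the one for which [f_tau ^ 2] becomes the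
average of this product over the fixed set [Z_1(0)] ([f_tauE]).  On that set
[a] and [b] have norm at most 1, so the average is within [O(tau)] of [f ^ 2].
Differentiating under the integral sign shows that the partial derivatives of
[f_tau ^ 2] are the averages of the differentiated product, hence within
[O(tau)] of those of [f ^ 2], because [f] and its partial derivatives are
Lipschitz on balls.  Where [f] is bounded below by [m > 0], taking the square
root costs only a constant depending on [m] ([partial_f_tau_near]).

Stability of the flow.  Let [u] and [v] be the two trajectories up to time [T],
[e] the squared Euclidean distance between them.  As long as [v] stays in the
tube of radius [delta] around [u] where the fields differ by at most
[eta + L |v - u|], one has [e' <= c e + k] with [k = O(eta ^ 2)], so that
[(e + k) exp (- c t)] decreases and [e <= k exp (c T)].  When [eta] is small
enough this bound lies below [delta ^ 2], so the first exit time from the tube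
cannot exist ([perturbed_flow_near]).  Since [f] is bounded below along
[u] on [[0, T]], both parts apply, with [eta] proportional to [tau].

Finiteness and positivity of the volume of [Z_1(0)] come for free: were either
to fail, [f_tau] would vanish identically and have no positive value at the
starting point of the trajectory ([fine_Lambda1_gt0]). *)

Set Implicit Arguments.
Unset Strict Implicit.
Unset Printing Implicit Defensive.

Import Order.TTheory GRing.Theory Num.Theory.
Import numFieldNormedType.Exports.

Local Open Scope classical_set_scope.
Local Open Scope ring_scope.

(** * Affine changes of variables and densities *)

Section change_of_variables.
Context (R : realType).

(** Lebesgue measure is characterized by its values on half-open intervals, where
[c] times the image of the measure by [s |-> a + c s] agrees with it. *)
Lemma ge0_integral_affine (a c : R) (g : R -> \bar R) : 0 < c ->
  measurable_fun setT g -> (forall s, 0 <= g s)%E ->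
  (\int[lebesgue_measure]_s g s =
   c%:E * \int[lebesgue_measure]_s g (a + c * s)%R)%E.
Proof.
move=> c0 mg g0.
pose phi (s : measurableTypeR R) : measurableTypeR R := (a + c * s)%R.
have mphi : measurable_fun setT phi.
  by apply: measurable_funD => //; exact: measurable_funM.
pose image_measure : {measure set (measurableTypeR R) -> \bar R} :=
  pushforward (@lebesgue_measure R) phi.
pose mu : {measure set (measurableTypeR R) -> \bar R} :=
  mscale (NngNum (ltW c0)) (image_measure mphi).
have muE (A : set (measurableTypeR R)) : measurable A -> lebesgue_measure A = mu A.
  apply: lebesgue_measure_unique => _ [[x y] _ <-] /=.
  rewrite /mu /= /mscale /= /pushforward /=.
  rewrite (_ : _ @^-1` _ = `](x - a) / c, (y - a) / c]%classic); last first.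
    apply/seteqP; split => s /=; rewrite !in_itv /= /phi ltr_pdivrMr// ler_pdivlMr//;
     by rewrite ltrBlDl lerBrDl [s * c]mulrC.
  rewrite !lebesgue_measure_itv /= !lte_fin ltr_pM2r ?invr_gt0// ltrD2r.
  case: ifPn => _; last by rewrite mule0.
  by rewrite -!EFinB -EFinM; congr (_%:E); field; rewrite gt_eqF.
rewrite (eq_measure_integral mu); last by move=> A mA _; exact: muE.
rewrite ge0_integral_mscale//; congr (_ * _)%E.
by rewrite ge0_integral_pushforward.
Qed.

Lemma measurable_rV_affine d (T : measurableType d) n (a : 'rV[R]_n) (c : R)
    (h : T -> 'rV[R]_n) :
  measurable_fun setT h -> measurable_fun setT (fun v => a + c *: h v).
Proof.
move=> mh; apply: measurable_fun_rV => i.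
under eq_fun do rewrite !mxE.
apply: measurable_funD => //; apply: measurable_funM => //.
exact: (measurableT_comp (measurable_rV_coord i) mh).
Qed.

Lemma ge0_integral_lebesgue_cons n (mu : {sigma_finite_measure set 'rV[R]_n -> \bar R})
    (g : 'rV[R]_n.+1 -> \bar R) :
  measurable_fun setT g -> (forall v, 0 <= g v)%E ->
  (\int[lebesgue_cons mu]_v g v =
   \int[lebesgue_measure]_s \int[mu]_v g (rV_cons (s, v)))%E.
Proof.
move=> mg g0.
have mcons : measurable_fun [set: measurableTypeR R * 'rV[R]_n] (@rV_cons R n).
  exact: measurable_rV_cons.
have mgc := measurableT_comp mg mcons.
rewrite -(@fubini_tonelli1 _ _ _ _ _ (@lebesgue_measure R) mu _ mgc) => [|z];
  last exact: g0.
have := @ge0_integral_pushforward _ _ _ _ _ _ mcons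
  (@lebesgue_measure R \x mu)%E setT g measurableT mg (fun v _ => g0 v).
by rewrite preimage_setT.
Qed.

Lemma rV_cons_affine n (a : 'rV[R]_n.+1) (c s : R) (v : 'rV[R]_n) :
  rV_cons (a ord0 ord0 + c * s, (\row_i a ord0 (lift ord0 i)) + c *: v) =
  a + c *: rV_cons (s, v).
Proof.
apply/rowP => i; rewrite [RHS]mxE [X in _ = _ + X]mxE.
case: (unliftP ord0 i) => [j|] ->; rewrite !(rV_consS, rV_cons0) //.
by rewrite !mxE.
Qed.

(** By induction on the dimension: Lebesgue measure on R^(n+1) is an image of a
product, so Tonelli's theorem reduces to one coordinate and R^n, each of which
contributes its own power of [c]. *)
Lemma ge0_integral_rV_affine n (a : 'rV[R]_n) (c : R) (g : 'rV[R]_n -> \bar R) :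
  0 < c -> measurable_fun setT g -> (forall v, 0 <= g v)%E ->
  (\int[lebesgue_rV R n]_v g v =
   (c ^+ n)%:E * \int[lebesgue_rV R n]_v g (a + c *: v)%R)%E.
Proof.
move=> c0; elim: n => [|n IH] in a g *; move=> mg g0.
  rewrite expr0 mul1e; apply: eq_integral => v _.
  by congr g; apply/rowP => -[].
rewrite /= !ge0_integral_lebesgue_cons//; last first.
  exact: (measurableT_comp mg (measurable_rV_affine a c (@measurable_id _ _ _))).
pose a' : 'rV[R]_n := \row_i a ord0 (lift ord0 i).
have mcons s : measurable_fun setT (fun v : 'rV[R]_n => g (rV_cons (s, v))).
  apply: (measurableT_comp mg).
  apply: (measurableT_comp (@measurable_rV_cons R n)).
  exact: measurable_fun_pair.
rewrite (@ge0_integral_affine (a ord0 ord0) c)//; last 2 first.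
- apply: (@measurable_fun_fubini_tonelli_F _ _ _ _ _ (lebesgue_rV R n)
    (fun z => g (rV_cons z))) => //.
  exact: (measurableT_comp mg (@measurable_rV_cons R n)).
- by move=> s; exact: integral_ge0.
rewrite exprS EFinM -muleA; congr (_ * _)%E.
under eq_integral => s _.
  rewrite (IH a')//; under [X in (_ * X)%E]eq_integral do rewrite rV_cons_affine.
  over.
rewrite ge0_integralZl ?lee_fin ?exprn_ge0 ?ltW//.
- apply: (@measurable_fun_fubini_tonelli_F _ _ _ _ _ (lebesgue_rV R n)
    (fun z => g (a + c *: rV_cons z))) => //.
  apply: (measurableT_comp mg).
  exact: (measurable_rV_affine a c (@measurable_rV_cons R n)).
- by move=> s _; exact: integral_ge0.
Qed.

End change_of_variables.

Section density.
Context (R : realType) (p : nat).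
Implicit Types (P : probability 'rV[R]_p R) (f : 'rV[R]_p -> R).

(** The density agrees almost everywhere with the Radon-Nikodym derivative, since
both have the same integral over every measurable set. *)
Lemma ge0_integral_density P f (g : 'rV[R]_p -> \bar R) :
  P `<< lebesgue_rV R p -> is_density P f ->
  measurable_fun setT g -> (forall v, 0 <= g v)%E ->
  (\int[P]_v g v = \int[lebesgue_rV R p]_v (g v * (f v)%:E))%E.
Proof.
move=> ac [mf f0 Pf] mg g0.
pose rn := Radon_Nikodym_SigmaFinite.f P (lebesgue_rV R p).
have irn : (lebesgue_rV R p).-integrable setT rn.
  exact: Radon_Nikodym_SigmaFinite.f_integrable.
have mrn := measurable_int _ irn.
rewrite -(Radon_Nikodym_SigmaFinite.change_of_variables ac)//.
apply: ge0_ae_eq_integral => //.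
- exact: emeasurable_funM.
- by apply: emeasurable_funM => //; exact/measurable_EFinP.
- by move=> x _; rewrite mule_ge0//; exact: Radon_Nikodym_SigmaFinite.f_ge0.
- by move=> x _; rewrite mule_ge0// lee_fin.
apply: ae_eqe_mul2l; apply: integral_ae_eq => //; first exact/measurable_EFinP.
by move=> E _ mE; rewrite -Pf// -Radon_Nikodym_SigmaFinite.f_integral.
Qed.

End density.

(** * The lens depth as an integral over a fixed set *)

Section lens_integral.
Context (R : realType) (p : nat).
Implicit Types (P : probability 'rV[R]_p R) (f : 'rV[R]_p -> R) (x : 'rV[R]_p).

Lemma enormZ (c : R) (v : 'rV[R]_p) : 0 <= c -> enorm (c *: v) = c * enorm v.
Proof.
move=> c0; rewrite /enorm; under eq_bigr do rewrite mxE exprMn.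
by rewrite -mulr_sumr sqrtrM ?sqr_ge0// sqrtr_sqr ger0_norm.
Qed.

Lemma normr_le_enorm (v : 'rV[R]_p) : `|v| <= enorm v.
Proof.
rewrite [leLHS]/Num.Def.normr/= mx_normrE.
apply: bigmax_le => [|[i j] _]; first exact: sqrtr_ge0.
rewrite ord1 /= -sqrtr_sqr ler_wsqrtr// (bigD1 j)//= lerDl.
by apply: sumr_ge0 => k _; exact: sqr_ge0.
Qed.

Lemma measurable_enorm d (T : measurableType d) (h : T -> 'rV[R]_p) :
  measurable_fun setT h -> measurable_fun setT (fun z => enorm (h z)).
Proof.
move=> mh; apply: (@measurableT_comp _ _ _ _ _ _ (@Num.sqrt R)).
  by apply: continuous_measurable_fun; exact: sqrt_continuous.
apply: measurable_sum => i; apply: measurable_funX.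
exact: (measurableT_comp (measurable_rV_coord i) mh).
Qed.

Lemma measurable_rV_sub d (T : measurableType d) (g h : T -> 'rV[R]_p) :
  measurable_fun setT g -> measurable_fun setT h ->
  measurable_fun setT (fun z => g z - h z).
Proof.
move=> mg mh; apply: measurable_fun_rV => i.
under eq_fun do rewrite !mxE.
by apply: measurable_funB; apply: (measurableT_comp (measurable_rV_coord i)).
Qed.

Lemma measurable_Zset (tau : R) x : measurable (Zset tau%:E x).
Proof.
have m12 : measurable_fun [set: 'rV[R]_p * 'rV[R]_p] (fun z => enorm (z.1 - z.2)).
  by apply: measurable_enorm; exact: measurable_rV_sub.
rewrite (_ : Zset _ _ =
  [set z | Num.max (enorm (x - z.1)) (enorm (x - z.2)) <= enorm (z.1 - z.2)] `&`
  [set z | enorm (z.1 - z.2) <= tau]); last first.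
  by apply/seteqP; split => z; rewrite /Zset /= lee_fin.
apply: measurableI; rewrite -[X in measurable X]setTI.
  apply: measurable_fun_le => //.
  by apply: measurable_maxr; apply: measurable_enorm; apply: measurable_rV_sub.
exact: measurable_fun_le.
Qed.

Lemma Zset_affine (tau : R) x (a b : 'rV[R]_p) : 0 < tau ->
  Zset tau%:E x (x + tau *: a, x + tau *: b) <-> Zset 1%E 0 (a, b).
Proof.
move=> t0; have t0' := ltW t0.
rewrite /Zset /= !opprD !addNKr -!scalerN !addrA.
rewrite [x + _]addrC addrK -scalerDr !enormZ// -maxr_pMr// ler_pM2l//.
by rewrite !sub0r !lee_fin ger_pMr.
Qed.

Lemma Zset1_norm_le (z : 'rV[R]_p * 'rV[R]_p) :
  Zset 1%E 0 z -> `|z.1| <= 1 /\ `|z.2| <= 1.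
Proof.
rewrite /Zset /= !sub0r ge_max lee_fin => -[/andP[z1 z2] z12].
by split; rewrite -normrN (le_trans (normr_le_enorm _))// (le_trans _ z12).
Qed.

Lemma measurable_slice (H : 'rV[R]_p * 'rV[R]_p -> \bar R) (a : 'rV[R]_p)
    (h : 'rV[R]_p -> 'rV[R]_p) :
  measurable_fun setT H -> measurable_fun setT h ->
  measurable_fun setT (fun b => H (a, h b)).
Proof.
move=> mH mh; apply: (measurableT_comp mH).
exact: (measurable_fun_pair (measurable_cst a) mh).
Qed.

(** Tonelli's theorem separates the two points; in each of them the density
replaces [P] and an affine change of variables, at the cost of a factor
[tau ^ p], moves the lens at [x] of scale [tau] to the unit lens at the
origin. *)
Lemma LLDE P f x (tau : R) : P `<< lebesgue_rV R p -> is_density P f -> 0 < tau ->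
  LLD P x tau%:E = ((tau ^+ p * tau ^+ p)%:E *
    \int[lebesgue_rV R p \x lebesgue_rV R p]_(z in Zset 1%E 0)
      (f (x + tau *: z.1) * f (x + tau *: z.2))%:E)%E.
Proof.
move=> ac df t0; have [mf f0 _] := df.
have tp0 : 0 <= tau ^+ p by rewrite exprn_ge0// ltW.
have mZ := measurable_Zset tau x.
have mZ1 := measurable_Zset 1 0.
have mfa : measurable_fun setT (fun b : 'rV[R]_p => f (x + tau *: b)).
  by apply: (measurableT_comp mf); exact: measurable_rV_affine.
pose H (z : 'rV[R]_p * 'rV[R]_p) : \bar R := (\1_(Zset tau%:E x) z * f z.2)%:E.
have mH : measurable_fun setT H.
  apply/measurable_EFinP; apply: measurable_funM => //.
  exact: (measurableT_comp mf).
have H0 z : (0 <= H z)%E by rewrite lee_fin mulr_ge0.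
pose K (z : 'rV[R]_p * 'rV[R]_p) : \bar R :=
  (\1_(Zset 1%E 0) z * (f (x + tau *: z.1) * f (x + tau *: z.2)))%:E.
have mK : measurable_fun setT K.
  apply/measurable_EFinP; apply: measurable_funM => //.
  by apply: measurable_funM; apply: (measurableT_comp mfa).
have K0 z : (0 <= K z)%E by rewrite lee_fin !mulr_ge0.
have HE z : H z = (\1_(Zset tau%:E x) z * f z.2)%:E by [].
have KE z : K z =
  (\1_(Zset 1%E 0) z * (f (x + tau *: z.1) * f (x + tau *: z.2)))%:E by [].
clearbody H K.
pose F := fubini_F (lebesgue_rV R p) H.
have mF : measurable_fun setT F by exact: measurable_fun_fubini_tonelli_F.
have F0 a : (0 <= F a)%E by exact: integral_ge0.
have LLDF : LLD P x tau%:E = (\int[P]_a F a)%E.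
  rewrite /LLD fubini_tonelli1//=; last exact/measurable_EFinP.
  apply: eq_integral => a _; rewrite /F /fubini_F.
  under [in RHS]eq_integral do rewrite HE EFinM.
  rewrite (ge0_integral_density ac df)//.
  apply/measurable_EFinP; apply: (measurableT_comp (measurable_indic mZ)).
  exact: measurable_fun_pair.
have FK a : (F (x + tau *: a)%R * (f (x + tau *: a))%:E =
    (tau ^+ p)%:E * \int[lebesgue_rV R p]_b K (a, b))%E.
  rewrite /F /fubini_F (ge0_integral_rV_affine x t0
    (measurable_slice (x + tau *: a) mH (@measurable_id _ _ setT)))//.
  rewrite -muleA -ge0_integralZr//.
  - congr (_ * _)%E; apply: eq_integral => b _; rewrite HE KE -EFinM.
    rewrite !indicE; congr (_%:E).
    have -> : ((x + tau *: a, x + tau *: b) \in Zset tau%:E x) = ((a, b) \in Zset 1%E 0).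
      have [Z1 Z2] := Zset_affine x a b t0.
      by apply/idP/idP => /set_mem Zab; apply: mem_set; [exact: Z1|exact: Z2].
    by rewrite /= -mulrA; congr (_ * _); rewrite mulrC.
  - exact: (measurable_slice (x + tau *: a) mH
      (measurable_rV_affine x tau (@measurable_id _ _ setT))).
  - by rewrite lee_fin.
rewrite LLDF (ge0_integral_density ac df)//.
rewrite (ge0_integral_rV_affine x t0)//; last 2 first.
- by apply: emeasurable_funM => //; exact/measurable_EFinP.
- by move=> v; rewrite mule_ge0// lee_fin.
under eq_integral do rewrite FK.
rewrite ge0_integralZl ?lee_fin//; last 2 first.
- exact: (@measurable_fun_fubini_tonelli_F _ _ _ _ _ (lebesgue_rV R p) K).
- by move=> a _; exact: integral_ge0.
rewrite -(@fubini_tonelli1 _ _ _ _ _ (lebesgue_rV R p) (lebesgue_rV R p) K)//.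
rewrite muleA -EFinM; congr (_ * _)%E.
rewrite [RHS]integral_mkcond; apply: eq_integral => z _.
rewrite KE patchE indicE; case: ifP => _; first by rewrite mul1r.
by rewrite mul0r.
Qed.

End lens_integral.

(** * Functions with continuous partial derivatives *)

Section calculus.
Context (R : realType) (p : nat).
Implicit Types (x z w v : 'rV[R]_p) (f g : 'rV[R]_p -> R).

Lemma normr_coord_le v i : `|v ord0 i| <= `|v|.
Proof.
rewrite [leRHS]/Num.Def.normr/= mx_normrE.
exact: (le_bigmax _ (fun i : 'I_1 * 'I_p => `|v i.1 i.2|) (ord0, i)).
Qed.

Lemma normr_rV_le v (r : R) : 0 <= r -> (forall i, `|v ord0 i| <= r) -> `|v| <= r.
Proof.
move=> r0 vr; rewrite [leLHS]/Num.Def.normr/= mx_normrE.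
by apply: bigmax_le => // -[i j] _; rewrite ord1.
Qed.

(** Directional derivatives are read as derivatives of functions of one real
variable, for which the mean value theorem and the chain rule are available. *)
Lemma is_derive_line f z v (s : R) : derivable f (z + s *: v) v ->
  is_derive s (1 : R) (fun t : R => f (z + t *: v)) ('D_v f (z + s *: v)).
Proof.
move=> dfv.
have E : (fun h : R => h^-1 *: (f (z + (h *: (1 : R) + s) *: v) - f (z + s *: v))) =
  (fun h : R => h^-1 *: ((f \o shift (z + s *: v)) (h *: v) - f (z + s *: v))).
  apply/funext => h /=; congr (_ *: (f _ - _)).
  by rewrite [h *: 1]mulr1 scalerDl addrCA.
by split; rewrite /derivable /derive /= E.
Qed.

(** Only partial derivatives are known to exist, so [z] is moved to [w] one
coordinate at a time, with the mean value theorem at each move.  The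
intermediate points stay in the ball because balls of the sup norm are boxes. *)
Lemma bounded_partial_lipschitz f (r M : R) z w :
  (forall i y, derivable f y (delta_mx ord0 i)) ->
  (forall i y, `|y| <= r -> `|partial f i y| <= M) ->
  `|z| <= r -> `|w| <= r -> `|f w - f z| <= p%:R * M * `|w - z|.
Proof.
move=> df fM zr wr; have r0 : 0 <= r := le_trans (normr_ge0 _) zr.
(* [y k] has its first [k] coordinates taken from [w], the others from [z]. *)
pose y k : 'rV[R]_p := \row_i if (i < k)%N then w ord0 i else z ord0 i.
have y0 : y 0%N = z by apply/rowP => i; rewrite mxE.
have yp : y p = w by apply/rowP => i; rewrite mxE ltn_ord.
rewrite -[in f w]yp -[in f z]y0 -(telescope_sumr (fun k => f (y k)))//.
rewrite big_mkord (le_trans (ler_norm_sum _ _ _))//.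
suff step (k : 'I_p) : `|f (y k.+1) - f (y k)| <= M * `|w - z|.
  apply: (le_trans (ler_sum _ (fun k _ => step k))).
  by rewrite sumr_const card_ord -mulrA mulr_natl.
pose h := w ord0 k - z ord0 k; pose e : 'rV[R]_p := delta_mx ord0 k.
have yE (c : R) i : (y k + (c * h) *: e) ord0 i =
    if i == k then z ord0 k + c * h else y k ord0 i.
  rewrite !mxE /=; case: eqVneq => [->|_]; last by rewrite mulr0 addr0.
  by rewrite ltnn mulr1.
have y1 : y k.+1 = y k + (1 * h) *: e.
  apply/rowP => i; rewrite yE /h mul1r addrC subrK !mxE ltnS.
  by case: eqVneq => [->|ik]; rewrite ?leqnn// leq_eqVlt val_eqE (negbTE ik).
have {1}-> : y k = y k + (0 * h) *: e by rewrite mul0r scale0r addr0.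
rewrite y1.
pose phi (s : R) := f (y k + (s * h) *: e).
have dphi s : is_derive s (1 : R) phi (h * partial f k (y k + (s * h) *: e)).
  have d1 : is_derive s (1 : R) (fun s : R => s * h) h.
    by apply: is_derive_eq; rewrite scaler0 add0r [_ *: _]mulr1.
  rewrite mulrC.
  apply: (@is_derive1_comp _ (fun t => f (y k + t *: e)) (fun s : R => s * h)).
  by apply: is_derive_line; exact: df.
have [|c c01 ->] := MVT ltr01 (fun s _ => dphi s).
  apply: derivable_within_continuous => s _; exact: ex_derive.
rewrite subr0 mulr1 normrM mulrC ler_pM//.
  apply: fM; apply: normr_rV_le => // i; rewrite yE.
  move: c01; rewrite in_itv /= => /andP[c0 c1].
  have zk := le_trans (normr_coord_le z k) zr.
  have wk := le_trans (normr_coord_le w k) wr.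
  case: eqVneq => _; last first.
    by rewrite mxE; case: ifP => _; exact: le_trans (normr_coord_le _ _) _.
  move: zk wk; rewrite /h !ler_norml => /andP[? ?] /andP[? ?]; apply/andP; split; nra.
by have := normr_coord_le (w - z) k; rewrite !mxE.
Qed.

Lemma continuous_bounded_ball f (r : R) : continuous f ->
  exists2 M, 0 <= M & forall y, `|y| <= r -> `|f y| <= M.
Proof.
move=> cf.
have cK : compact [set y : 'rV[R]_p | `|y| <= r].
  apply: bounded_closed_compact.
    exists r; split => [|s rs y yr]; first exact: num_real.
    exact: le_trans yr (ltW rs).
  rewrite (_ : mkset _ = (fun y : 'rV[R]_p => `|y|) @^-1` [set s : R | s <= r])//.
  by apply: closed_comp => [y _|]; [exact: norm_continuous|exact: closed_le].
have cfK : {within [set y : 'rV[R]_p | `|y| <= r], continuous f}.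
  exact: continuous_subspaceT.
have /compact_bounded[M [_ fM]] := continuous_compact cfK cK.
exists (`|M| + 1) => // y yr; apply: (fM (`|M| + 1)); last by exists y.
by rewrite ltr_pwDr// ler_norm.
Qed.

Lemma C1_lipschitz_ball f (r : R) : Ck 1 f ->
  exists2 L, 0 <= L &
    forall z w, `|z| <= r -> `|w| <= r -> `|f w - f z| <= L * `|w - z|.
Proof.
move=> [_ C1f].
have /choice[M MP] i : exists M, 0 <= M /\ forall y, `|y| <= r -> `|partial f i y| <= M.
  have [_ [c _]] := C1f i.
  by have [M M0 fM] := continuous_bounded_ball r c; exists M.
have S0 : 0 <= \sum_i M i by apply: sumr_ge0 => i _; exact: (MP i).1.
exists (p%:R * \sum_i M i) => [|z w zr wr]; first by rewrite mulr_ge0.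
apply: bounded_partial_lipschitz zr wr => [i y|i y yr]; first exact: (C1f i).1.
apply: (le_trans ((MP i).2 _ yr)); rewrite (bigD1 i)//= lerDl.
by apply: sumr_ge0 => j _; exact: (MP j).1.
Qed.

(** A partial derivative is the pointwise limit of the difference quotients with
steps [1 / (n + 1)], which are measurable. *)
Lemma measurable_partial f i : measurable_fun setT f ->
  (forall y, derivable f y (delta_mx ord0 i)) ->
  measurable_fun setT (partial f i).
Proof.
move=> mf df.
pose e : 'rV[R]_p := delta_mx ord0 i.
pose q n y := (n.+1%:R^-1 : R)^-1 *: (f (n.+1%:R^-1 *: e + y) - f y).
apply: (@measurable_fun_cvg _ _ _ _ q).
- move=> n; rewrite /q; apply: measurable_funM => //.
  apply: measurable_funB => //; apply: (measurableT_comp mf).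
  rewrite [X in measurable_fun _ X](_ : _ =
      fun y : 'rV[R]_p => n.+1%:R^-1 *: e + 1 *: y).
    exact: measurable_rV_affine.
  by apply/funext => y; rewrite scale1r.
- move=> y _; have /cvgr_dnbhsP := df y.
  apply; split => [n|]; first by rewrite invr_neq0.
  exact: cvg_harmonic.
Qed.

End calculus.

(** * Averages over a set of finite measure *)

Section mean_value.
Context d (T : measurableType d) (R : realType) (mu : {measure set T -> \bar R}).

Lemma bounded_integrable (D : set T) (h : T -> R) (M : R) :
  measurable D -> (mu D < +oo)%E -> measurable_fun D h ->
  (forall z, D z -> `|h z| <= M) -> mu.-integrable D (EFin \o h).
Proof.
move=> mD Doo mh hM; apply: measurable_bounded_integrable => //.
exists M; split => [|s Ms z Dz]; first exact: num_real.
exact: le_trans (hM _ Dz) (ltW Ms).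
Qed.

Lemma Rintegral_mean_near (D : set T) (h : T -> R) (c e : R) :
  measurable D -> 0 < fine (mu D) -> measurable_fun D h ->
  (forall z, D z -> `|h z - c| <= e) ->
  `|(fine (mu D))^-1 * (\int[mu]_(z in D) h z) - c| <= e.
Proof.
move=> mD mu0 mh he.
have Doo : (mu D < +oo)%E.
  by rewrite ltNge leye_eq; apply/eqP => muD; rewrite muD ltxx in mu0.
have iB : mu.-integrable D (EFin \o (fun z => h z - c)).
  by apply: bounded_integrable he => //; apply: measurable_funB.
have ic (k : R) : mu.-integrable D (EFin \o (fun=> k)).
  by apply: (@bounded_integrable _ _ `|k|) => // z _.
have ih : mu.-integrable D (EFin \o h).
  apply: (@bounded_integrable _ _ (e + `|c|)) => // z Dz.
  by rewrite -[h z](subrK c) (le_trans (ler_normD _ _))// lerD2r; exact: he.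
have -> : (fine (mu D))^-1 * (\int[mu]_(z in D) h z) - c =
    (fine (mu D))^-1 * \int[mu]_(z in D) (h z - c).
  by rewrite RintegralB// Rintegral_cst//; field; rewrite gt_eqF.
rewrite normrM gtr0_norm ?invr_gt0// mulrC ler_pdivrMr//.
apply: le_trans (le_normr_Rintegral mD iB) _.
by rewrite -Rintegral_cst//; apply: le_Rintegral => //; exact: integrable_norm iB.
Qed.

End mean_value.

(** * Convergence of the local depth and of its gradient *)

Section gradient_estimate.
Context (R : realType) (p : nat).
Implicit Types (P : probability 'rV[R]_p R) (f : 'rV[R]_p -> R) (x : 'rV[R]_p).

Local Notation mu2 := (lebesgue_rV R p \x lebesgue_rV R p)%E.
Local Notation Z1 := (@Zset R p 1%E 0).
Local Notation e_ i := (delta_mx ord0 i : 'rV[R]_p).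

(** The average of [f (x + tau a) f (x + tau b)] over the unit lens, that is, the
square of [f_tau]. *)
Definition lens_mean f (tau : R) x : R :=
  (fine (Lambda1 R p))^-1 *
  \int[mu2]_(z in Z1) (f (x + tau *: z.1) * f (x + tau *: z.2)).

(** The factors [tau ^ p] coming from [LLDE] cancel the normalization. *)
Lemma f_tauE P f (tau : R) x : P `<< lebesgue_rV R p -> is_density P f ->
  0 < tau -> f_tau P tau x = Num.sqrt (lens_mean f tau x).
Proof.
move=> ac df t0; rewrite /f_tau (LLDE x ac df t0) /lens_mean /Rintegral.
have fineZ (r : R) (y : \bar R) : 0 < r -> fine (r%:E * y) = r * fine y.
  move=> r0; case: y => [y| |] //=.
    by rewrite gt0_muley ?lte_fin// mulr0.
  by rewrite gt0_muleNy ?lte_fin// mulr0.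
have tp0 : 0 < tau ^+ p by rewrite exprn_gt0.
rewrite fineZ ?mulr_gt0// sqrtrM ?mulr_ge0 ?ltW// -expr2 sqrtr_sqr ger0_norm ?ltW//.
rewrite sqrtrM ?invr_ge0 ?fine_ge0// sqrtrV ?fine_ge0//.
by rewrite invfM mulrACA mulVf ?gt_eqF// mul1r.
Qed.

Lemma Zset1_shift_le (tau : R) x z : 0 < tau -> tau <= 1 -> Z1 z ->
  [/\ `|x + tau *: z.1 - x| <= tau, `|x + tau *: z.2 - x| <= tau,
      `|x + tau *: z.1| <= `|x| + 1 & `|x + tau *: z.2| <= `|x| + 1].
Proof.
move=> t0 t1 /Zset1_norm_le[z1 z2].
have E (v : 'rV[R]_p) : `|v| <= 1 -> `|tau *: v| <= tau.
  by move=> v1; rewrite normrZ gtr0_norm// ger_pMr.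
rewrite ![x + _ - x]addrAC !subrr !add0r; split; [exact: E|exact: E|..];
  by rewrite (le_trans (ler_normD _ _))// lerD2l (le_trans (E _ _)).
Qed.

(** The [i]-th partial derivative of [lens_mean], as obtained by differentiating
the product under the integral sign. *)
Definition lens_mean_partial f i (tau : R) x : R :=
  (fine (Lambda1 R p))^-1 *
  \int[mu2]_(z in Z1) (partial f i (x + tau *: z.1) * f (x + tau *: z.2) +
                       f (x + tau *: z.1) * partial f i (x + tau *: z.2)).

Lemma measurable_shift f (tau : R) x (h : 'rV[R]_p * 'rV[R]_p -> 'rV[R]_p) :
  measurable_fun setT f -> measurable_fun setT h ->
  measurable_fun setT (fun z => f (x + tau *: h z)).
Proof.
by move=> mf mh; apply: (measurableT_comp mf); exact: measurable_rV_affine.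
Qed.

(** Differentiation under the integral sign along the line [x + t e_i], for [t] in
]-1, 1[: all arguments of [f] then stay in the ball of radius [|x| + 2], where
[f] and its partial derivative are bounded, so that a constant dominates on a
set of finite measure. *)
Lemma is_derive_lens_mean f i (tau : R) x : (mu2 Z1 < +oo)%E ->
  measurable_fun setT f -> Ck 1 f -> 0 < tau -> tau <= 1 ->
  is_derive (0 : R) (1 : R) (fun t : R => lens_mean f tau (x + t *: e_ i))
    (lens_mean_partial f i tau x).
Proof.
move=> Zoo mf [cf C1f] t0 t1.
have [df [cdf _]] := C1f i.
have mdf := measurable_partial mf df.
have mZ1 : measurable Z1 by exact: measurable_Zset.
have [M M0 fM] := continuous_bounded_ball (`|x| + 2) cf.
have [N N0 dfN] := continuous_bounded_ball (`|x| + 2) cdf.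
pose g (t : R) (z : 'rV[R]_p * 'rV[R]_p) :=
  f (x + tau *: z.1 + t *: e_ i) * f (x + tau *: z.2 + t *: e_ i).
pose dg (t : R) (z : 'rV[R]_p * 'rV[R]_p) :=
  partial f i (x + tau *: z.1 + t *: e_ i) * f (x + tau *: z.2 + t *: e_ i) +
  f (x + tau *: z.1 + t *: e_ i) * partial f i (x + tau *: z.2 + t *: e_ i).
have ball2 (t : R) (v : 'rV[R]_p) : `|v| <= `|x| + 1 -> `|t| <= 1 ->
    `|v + t *: e_ i| <= `|x| + 2.
  move=> vx tle; rewrite (_ : 2 = 1 + 1)// addrA (le_trans (ler_normD _ _))//.
  apply: lerD => //; rewrite normrZ mulr_ile1//.
  apply: normr_rV_le => // j; rewrite mxE.
  by case: (_ && _); rewrite ?normr0 ?normr1.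
have is_dg t z : is_derive t (1 : R) (g ^~ z) (dg t z).
  have D k := @is_derive_line R p f (x + tau *: k z) (e_ i) t (df _).
  have D1 := D fst; have D2 := D snd.
  apply: is_derive_eq; rewrite /dg /partial addrC; congr (_ + _).
  by rewrite [LHS]mulrC.
have I01 : `](-1 : R), 1[%classic (0 : R) by rewrite /= in_itv /= ltrN10 ltr01.
have in_I (t : R) : `](-1 : R), 1[%classic t -> `|t| <= 1.
  by rewrite /= in_itv /= => /andP[? ?]; rewrite ler_norml !ltW.
have intg (t : R) : `](-1 : R), 1[%classic t -> mu2.-integrable Z1 (EFin \o g t).
  move=> It; apply: (@bounded_integrable _ _ _ mu2 _ _ (M * M)) => //.
    apply: measurable_funTS; rewrite /g.
    have shiftE k : (fun z : 'rV[R]_p * 'rV[R]_p => f (x + tau *: k z + t *: e_ i)) =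
        (fun z => f ((x + t *: e_ i) + tau *: k z)).
      by apply/funext => z; rewrite addrAC.
    apply: measurable_funM.
      by rewrite (shiftE fst); exact: measurable_shift.
    by rewrite (shiftE snd); exact: measurable_shift.
  move=> z /(Zset1_shift_le x t0 t1)[_ _ z1 z2].
  by rewrite normrM ler_pM// fM// ball2// in_I.
have dgM (t : R) z : `](-1 : R), 1[%classic t -> Z1 z ->
    `|partial1of2 g t z| <= N * M + M * N.
  move=> It /(Zset1_shift_le x t0 t1)[_ _ z1 z2].
  rewrite partial1of2E derive_val (le_trans (ler_normD _ _))// !normrM.
  by rewrite lerD// ler_pM// ?fM ?dfN// ball2// in_I.
have dgI t z : `](-1 : R), 1[%classic t -> Z1 z -> derivable (g ^~ z) t (1 : R).
  by move=> _ _; exact: ex_derive.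
have G0 (z : 'rV[R]_p * 'rV[R]_p) : 0 <= N * M + M * N.
  by rewrite addr_ge0// mulr_ge0.
have iG : mu2.-integrable Z1 (EFin \o (fun=> N * M + M * N)).
  by apply: (@bounded_integrable _ _ _ mu2 _ _ (N * M + M * N)) => // z _; rewrite ger0_norm ?(G0 z).
have cvgF := @cvg_differentiation_under_integral _ _ _ mu2 g Z1 mZ1 0 (-1) 1
  I01 intg dgI (fun=> N * M + M * N) G0 iG dgM.
have E1 : \int[mu2]_(z in Z1) (partial1of2 g 0 z) =
    \int[mu2]_(z in Z1) (partial f i (x + tau *: z.1) * f (x + tau *: z.2) +
                       f (x + tau *: z.1) * partial f i (x + tau *: z.2)).
  apply: eq_Rintegral => z _; rewrite partial1of2E derive_val /dg.
  by rewrite !scale0r !addr0.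
have isF : is_derive (0 : R) (1 : R) (fun t : R => \int[mu2]_(z in Z1) g t z)
    (\int[mu2]_(z in Z1) (partial f i (x + tau *: z.1) * f (x + tau *: z.2) +
                       f (x + tau *: z.1) * partial f i (x + tau *: z.2))).
  rewrite -E1.
  have E2 : (fun h : R => h^-1 *: (((fun t => \int[mu2]_(z in Z1) g t z) \o
       shift (0 : R)) (h *: (1 : R)) - \int[mu2]_(z in Z1) g 0 z)) =
     (fun h : R => h^-1 *: (\int[mu2]_(z in Z1) g (h + 0) z - \int[mu2]_(z in Z1) g 0 z)).
    by apply/funext => h /=; rewrite [h *: 1]mulr1.
  split; first by apply/cvg_ex; eexists; rewrite E2; exact: cvgF.
  by apply/cvg_lim => //; rewrite E2; exact: cvgF.
rewrite /lens_mean (_ : (fun t : R => _) =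
    (fine (Lambda1 R p))^-1 *: (fun t : R => \int[mu2]_(z in Z1) g t z)).
  exact: is_deriveZ.
apply/funext => t; congr (_ * _); apply: eq_Rintegral => z _.
by rewrite /g ![x + _ + t *: _]addrAC.
Qed.

(** Converse of [is_derive_line] at the origin of the line. *)
Lemma is_derive_line0 f x v (l : R) :
  is_derive (0 : R) (1 : R) (fun t : R => f (x + t *: v)) l -> is_derive x v f l.
Proof.
have E : (fun h : R => h^-1 *: (((fun t : R => f (x + t *: v)) \o shift (0 : R)) (h *: (1 : R)) - f (x + 0 *: v))) =
  (fun h : R => h^-1 *: ((f \o shift x) (h *: v) - f x)).
  apply/funext => h /=; congr (_ *: (f _ - f _)).
    by rewrite [h *: 1]mulr1 addr0 addrC.
  by rewrite scale0r addr0.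
by move=> [dl <-]; move: dl; rewrite /derivable /derive E => dl; split.
Qed.

Lemma prod_near (a a0 b b0 M e : R) : `|a - a0| <= e -> `|b - b0| <= e ->
  `|b| <= M -> `|a0| <= M -> `|a * b - a0 * b0| <= 2 * M * e.
Proof.
move=> aa bb bM aM.
have -> : a * b - a0 * b0 = (a - a0) * b + a0 * (b - b0) by ring.
rewrite (le_trans (ler_normD _ _))// !normrM.
rewrite (_ : 2 * M * e = e * M + M * e); last by ring.
by rewrite lerD// ler_pM.
Qed.

(** Write [G] for [f_tau ^ 2], [A] for its partial derivative and [s] for the
square root of [G], so that the partial derivative of [f_tau] is [A / (2 s)].
The averages [G] and [A] are within [2 M L tau] and [4 M L tau] of [f ^ 2] and
of its partial derivative [2 f D f], because this already holds for the
integrands.  The smallness condition on [tau] keeps [s] above [m / 2], whence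
[|s - f| <= 2 M L tau / m], and [A / (2 s) - D f] equals
[(A - 2 f D f + 2 (f - s) D f) / (2 s)]. *)
Lemma partial_f_tau_near P f (r M L m tau : R) x i :
  P `<< lebesgue_rV R p -> is_density P f -> 0 < fine (Lambda1 R p) -> Ck 1 f ->
  (forall y, `|y| <= r + 1 -> `|f y| <= M) ->
  (forall y, `|y| <= r + 1 -> `|partial f i y| <= M) ->
  (forall y w, `|y| <= r + 1 -> `|w| <= r + 1 -> `|f w - f y| <= L * `|w - y|) ->
  (forall y w, `|y| <= r + 1 -> `|w| <= r + 1 ->
    `|partial f i w - partial f i y| <= L * `|w - y|) ->
  0 <= L -> 0 < m -> 0 < tau -> tau <= 1 -> 4 * M * L * tau <= m ^+ 2 ->
  `|x| <= r -> m <= f x ->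
  `|partial (f_tau P tau) i x - partial f i x| <=
    (4 * M * L + 4 * M ^+ 2 * L / m) / m * tau.
Proof.
move=> ac dens L10 C1f fM dfM fL dfL L0 m0 t0 t1 tm xr mfx.
have [mf f0 _] := dens; have [df [cdf _]] := C1f.2 i.
have mdf := measurable_partial mf df.
have mZ1 : measurable Z1 by exact: measurable_Zset.
have Zoo : (mu2 Z1 < +oo)%E.
  by rewrite ltNge leye_eq; apply/eqP => muD; move: L10; rewrite /Lambda1 muD ltxx.
have r0 : 0 <= r := le_trans (normr_ge0 _) xr.
have xr1 : `|x| <= r + 1 by rewrite (le_trans xr)// lerDl.
have M0 : 0 <= M := le_trans (normr_ge0 _) (fM _ xr1).
have near z : Z1 z -> [/\ `|f (x + tau *: z.1) - f x| <= L * tau,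
    `|f (x + tau *: z.2) - f x| <= L * tau,
    `|partial f i (x + tau *: z.1) - partial f i x| <= L * tau &
    `|partial f i (x + tau *: z.2) - partial f i x| <= L * tau] /\
    `|f (x + tau *: z.2)| <= M /\ `|partial f i (x + tau *: z.2)| <= M.
  move=> /(Zset1_shift_le x t0 t1)[d1 d2 n1 n2].
  have n1' : `|x + tau *: z.1| <= r + 1 by rewrite (le_trans n1)// lerD2r.
  have n2' : `|x + tau *: z.2| <= r + 1 by rewrite (le_trans n2)// lerD2r.
  by split; [split|split; [exact: fM|exact: dfM]];
    [apply: le_trans (fL _ _ xr1 n1') _ | apply: le_trans (fL _ _ xr1 n2') _ |
     apply: le_trans (dfL _ _ xr1 n1') _ | apply: le_trans (dfL _ _ xr1 n2') _];
    rewrite ler_wpM2l.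
have Gnear : `|lens_mean f tau x - f x ^+ 2| <= 2 * M * (L * tau).
  apply: Rintegral_mean_near => //.
    by apply: measurable_funTS; apply: measurable_funM; exact: measurable_shift.
  move=> z /near[[? ? _ _] [? _]]; rewrite expr2; apply: prod_near => //.
  exact: fM.
have Anear : `|lens_mean_partial f i tau x - 2 * f x * partial f i x| <=
    4 * M * (L * tau).
  apply: Rintegral_mean_near => //.
    apply: measurable_funTS; apply: measurable_funD; apply: measurable_funM;
      exact: measurable_shift.
  move=> z /near[[? ? ? ?] [? ?]].
  rewrite (_ : _ - _ =
    (partial f i (x + tau *: z.1) * f (x + tau *: z.2) - partial f i x * f x) +
    (f (x + tau *: z.1) * partial f i (x + tau *: z.2) - f x * partial f i x));
    last by ring.
  rewrite (_ : 4 * M * (L * tau) = 2 * M * (L * tau) + 2 * M * (L * tau)); last by ring.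
  rewrite (le_trans (ler_normD _ _))// lerD//; apply: prod_near => //.
    exact: dfM.
  exact: fM.
set G := lens_mean f tau x in Gnear *.
set A := lens_mean_partial f i tau x in Anear *.
have G_ge : (m / 2) ^+ 2 <= G.
  move: Gnear; rewrite ler_distl => /andP[+ _].
  have : m ^+ 2 <= f x ^+ 2 by rewrite ler_sqr// nnegrE ?f0// ltW.
  have : 0 < m ^+ 2 by rewrite exprn_gt0.
  rewrite expr_div_n; nra.
have G0 : 0 < G by apply: lt_le_trans G_ge; rewrite exprn_gt0// divr_gt0.
have sG : m / 2 <= Num.sqrt G.
  have -> : m / 2 = Num.sqrt ((m / 2) ^+ 2).
    by rewrite sqrtr_sqr ger0_norm// divr_ge0// ltW.
  exact: ler_wsqrtr.
have -> : partial (f_tau P tau) i x = A * (2 * Num.sqrt G)^-1.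
  apply: derive_val; apply: is_derive_line0.
  have -> : (fun t : R => f_tau P tau (x + t *: e_ i)) =
      Num.sqrt \o (fun t : R => lens_mean f tau (x + t *: e_ i)).
    by apply/funext => t /=; rewrite (f_tauE _ ac dens t0).
  rewrite mulrC; apply: is_derive1_comp; last exact: is_derive_lens_mean.
  by rewrite scale0r addr0 -/G; exact: is_derive1_sqrt.
have sG0 : 0 < Num.sqrt G by rewrite sqrtr_gt0.
have GE : G = Num.sqrt G ^+ 2 by rewrite sqr_sqrtr// ltW.
set s := Num.sqrt G in sG sG0 GE *.
have sf : `|s - f x| <= 2 * M * L * tau / m.
  rewrite ler_pdivlMr//.
  apply: (@le_trans _ _ (`|s - f x| * (s + f x))).
    by rewrite ler_wpM2l// (le_trans mfx)// lerDr ltW.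
  rewrite -[s + f x]ger0_norm ?addr_ge0 ?(ltW sG0)// -normrM -subr_sqr -GE.
  by apply: le_trans Gnear _; rewrite mulrA.
rewrite (_ : _ - _ = (A - 2 * f x * partial f i x +
    2 * (f x - s) * partial f i x) / (2 * s)); last by field; rewrite gt_eqF.
rewrite normrM [`|_^-1|]gtr0_norm ?invr_gt0 ?mulr_gt0//.
rewrite ler_pdivrMr ?mulr_gt0//.
apply: (@le_trans _ _ ((4 * M * L + 4 * M ^+ 2 * L / m) * tau)).
  apply: (le_trans (ler_normD _ _)); rewrite [leRHS]mulrDl lerD//.
    by apply: le_trans Anear _; rewrite mulrA.
  rewrite !normrM (distrC _ s) ger0_norm//.
  rewrite (_ : 4 * _ ^+ 2 * _ / _ * _ = 2 * (2 * M * L * tau / m) * M); last first.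
    by field; rewrite gt_eqF.
  by rewrite ler_pM// ?mulr_ge0// ?ler_wpM2l// dfM.
set X := (4 * M * L + _).
rewrite (_ : X / m * tau * (2 * s) = X * tau * (2 * s / m)); last by ring.
apply: ler_peMr.
  have K1 : 0 <= 4 * M * L by rewrite !mulr_ge0.
  have K2 : 0 <= 4 * M ^+ 2 * L / m.
    by rewrite !mulr_ge0 ?invr_ge0 ?sqr_ge0// ltW.
  by apply: mulr_ge0; [exact: addr_ge0|exact: ltW].
by rewrite ler_pdivlMr// mul1r; lra.
Qed.

End gradient_estimate.

(** * Stability of a flow under perturbation of its field *)

Section perturbed_flow.
Context (R : realType) (p : nat).
Implicit Types (u v : R -> 'rV[R]_p) (w : 'rV[R]_p).

Definition sqnorm w : R := \sum_(i < p) w ord0 i ^+ 2.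

Lemma normr_sqr_le_sqnorm w : `|w| ^+ 2 <= sqnorm w.
Proof.
have S0 : 0 <= sqnorm w by apply: sumr_ge0 => i _; exact: sqr_ge0.
rewrite -[leRHS]sqr_sqrtr// ler_sqr ?nnegrE ?sqrtr_ge0//.
exact: normr_le_enorm.
Qed.

Lemma continuous_sqnorm : continuous sqnorm.
Proof.
rewrite (_ : sqnorm = \sum_(i < p) (fun w => w ord0 i ^+ 2)); last first.
  by apply/funext => w; rewrite fct_sumE.
elim/big_ind : _ => [|f g cf cg|i _] w.
- exact: (@cst_continuous _ _ (0 : R)).
- by apply: continuousD; [exact: cf|exact: cg].
- have ci : {for w, continuous (fun y : 'rV[R]_p => y ord0 i)}.
    exact: coord_continuous.
  exact: (continuousM ci ci).
Qed.

Lemma is_derive_coord u (t : R) w i : is_derive t (1 : R) u w ->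
  is_derive t (1 : R) (fun s => u s ord0 i) (w ord0 i).
Proof.
move=> [du <-]; split; first exact: (derivable_mxP u t 1).1.
by rewrite derive_mx// mxE.
Qed.

Lemma is_derive_sqnorm_sub u v (t : R) (a b : 'rV[R]_p) :
  is_derive t (1 : R) u a -> is_derive t (1 : R) v b ->
  is_derive t (1 : R) (fun s => sqnorm (v s - u s))
    (\sum_(i < p) 2 * ((v t - u t) ord0 i * (b - a) ord0 i)).
Proof.
move=> du dv.
rewrite (_ : (fun s => _) = \sum_(i < p) (fun s => (v s - u s) ord0 i ^+ 2)); last first.
  by apply/funext => s; rewrite fct_sumE.
apply: is_derive_sum => i.
have d : is_derive t (1 : R) (fun s => (v s - u s) ord0 i) ((b - a) ord0 i).
  by apply: is_derive_coord; exact: is_deriveB.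
by apply: is_derive_eq; rewrite -mulr2n [RHS]mulr_natl.
Qed.

Variables (F G : 'rV[R]_p -> 'rV[R]_p) (u v : R -> 'rV[R]_p) (T delta eta L : R).
Hypotheses (delta0 : 0 < delta) (L0 : 0 <= L).
Hypothesis uv0 : u 0 = v 0.
Hypothesis cu : {within `[0, +oo[, continuous u}.
Hypothesis cv : {within `[0, +oo[, continuous v}.
Hypothesis du : forall t : R, 0 < t -> is_derive t (1 : R) u (F (u t)).
Hypothesis dv : forall t : R, 0 < t -> is_derive t (1 : R) v (G (v t)).
Hypothesis FG : forall t w, 0 <= t <= T -> `|w - u t| < delta ->
  forall i, `|(G w - F (u t)) ord0 i| <= eta + L * `|w - u t|.

Let e (t : R) : R := sqnorm (v t - u t).
Let c : R := 1 + 2 * p%:R * L.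
Let k : R := p%:R * eta ^+ 2.

Let within_e (t : R) : {within `[0, t], continuous e}.
Proof.
move=> s.
have sub := @subset_itvl _ R (BLeft 0) (BRight t) +oo%O isT.
have cw : {for s, continuous ((v \- u) : subspace `[0, t] -> 'rV[R]_p)}.
  apply: continuousB; [exact: (continuous_subspaceW sub cv)|].
  exact: (continuous_subspaceW sub cu).
exact: (continuous_comp cw (@continuous_sqnorm _)).
Qed.

(** Termwise, [2 a b <= 2 |a| (eta + L |w|)], where [2 |a| eta <= a ^ 2 + eta ^ 2]
and [|a| |w| <= |w| ^ 2 <= e]; summing over the coordinates gives [c] and [k]. *)
Let deviation_derivative_le (t : R) : 0 <= t <= T -> e t < delta ^+ 2 ->
  \sum_(i < p) 2 * ((v t - u t) ord0 i * (G (v t) - F (u t)) ord0 i) <= c * e t + k.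
Proof.
move=> tT et; set w := v t - u t.
have wle : `|w| ^+ 2 <= e t by exact: normr_sqr_le_sqnorm.
have wd : `|w| < delta.
  rewrite -(@ltr_pXn2r _ 2) ?nnegrE ?normr_ge0 ?ltW//; exact: le_lt_trans et.
have -> : c * e t + k = \sum_(i < p) (w ord0 i ^+ 2 + (2 * L * e t + eta ^+ 2)).
  rewrite big_split /= sumr_const card_ord -[X in _ = _ + X]mulr_natl.
  have -> : \sum_(i < p) w ord0 i ^+ 2 = e t by [].
  by rewrite /c /k; ring.
apply: ler_sum => i _.
have : `|(G (v t) - F (u t)) ord0 i| <= eta + L * `|w| := FG tT wd i.
move: ((G (v t) - F (u t)) ord0 i) => b bL; set a := w ord0 i.
have aw : `|a| <= `|w| by exact: normr_coord_le.
have ab : a * b <= `|a| * (eta + L * `|w|).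
  by rewrite (le_trans (ler_norm _))// normrM ler_wpM2l.
have aLw : `|a| * (L * `|w|) <= L * e t.
  rewrite mulrCA ler_wpM2l// (le_trans _ wle)// expr2 ler_wpM2r//.
have aeta : 2 * (`|a| * eta) <= a ^+ 2 + eta ^+ 2.
  have := sqr_ge0 (`|a| - eta); rewrite sqrrB real_normK ?num_real// -subr_ge0; lra.
lra.
Qed.

(** Gronwall's argument: [e' <= c e + k] and [1 <= c] make [(e + k) exp (- c s)]
nonincreasing as long as the trajectory stays in the tube, and its initial
value is [k]. *)
Let deviation_le_before_exit (t : R) : 0 <= t <= T ->
  (forall s, 0 < s < t -> e s < delta ^+ 2) -> e t <= k * expR (c * T).
Proof.
move=> /andP[t0 tT] small.
have c0 : 1 <= c by rewrite lerDl !mulr_ge0.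
have k0 : 0 <= k by rewrite mulr_ge0// sqr_ge0.
pose phi (s : R) := (e s + k) * expR (- c * s).
have dphi (s : R) : s \in `]0, t[%R -> exists2 l,
    is_derive s (1 : R) phi ((l - c * (e s + k)) * expR (- c * s)) & l <= c * e s + k.
  rewrite in_itv /= => /andP[s0 st].
  exists (\sum_(i < p) 2 * ((v s - u s) ord0 i * (G (v s) - F (u s)) ord0 i)).
    have de := is_derive_sqnorm_sub (du s0) (dv s0).
    have d1 : is_derive s (1 : R) (fun s : R => - c * s) (- c).
      by apply: is_derive_eq; rewrite [LHS]mulr1.
    have d2 : is_derive s (1 : R) (expR \o (fun s : R => - c * s)) (expR (- c * s) * - c).
      exact: is_derive1_comp.
    have d3 : is_derive s (1 : R) (fun s => e s + k)
      (\sum_(i < p) 2 * ((v s - u s) ord0 i * (G (v s) - F (u s)) ord0 i)).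
      by apply: is_derive_eq; rewrite addr0.
    rewrite /phi.
    have := @is_deriveM _ _ _ _ _ _ _ _ d3 d2.
    move=> /is_derive_eq; apply; rewrite /GRing.scale /=; ring.
  apply: deviation_derivative_le; last by apply: small; rewrite s0.
  by rewrite (ltW s0) (le_trans (ltW st)).
have : phi t <= phi 0.
  apply: (@ler0_derive1_le_cc _ phi 0 t); rewrite ?in_itv /= ?lexx ?t0//.
  - by move=> s /dphi[l d _]; exact: ex_derive.
  - move=> s /dphi[l d l_le]; rewrite derive1E derive_val.
    rewrite mulr_le0_ge0 ?expR_ge0// subr_le0 (le_trans l_le)// mulrDr lerD2l.
    by rewrite ler_peMl.
  - have cexp : continuous (fun r : R => expR (- c * r)).
      move=> z; apply: (@continuous_comp _ _ _ (fun r : R => - c * r) expR).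
        exact: mulrl_continuous.
      exact: continuous_expR.
    move=> s.
    have c1 : {for s, continuous ((e \+ cst k) : subspace `[0, t] -> R)}.
      by apply: continuousD; [exact: within_e|exact: cst_continuous].
    have c2 : {within `[0, t], continuous (fun r : R => expR (- c * r))}.
      exact: continuous_subspaceT.
    exact: (continuousM c1 (c2 s)).
rewrite /phi mulr0 expR0 mulr1 {2}/e uv0 subrr.
rewrite (_ : sqnorm 0 = 0) ?add0r; last first.
  by apply: big1 => i _; rewrite mxE expr0n.
rewrite mulNr expRN ler_pdivrMr ?expR_gt0// => ek.
apply: (@le_trans _ _ (k * expR (c * t))).
  by apply: le_trans ek; rewrite lerDl.
by rewrite ler_wpM2l// ler_expR ler_wpM2l// (le_trans _ c0).
Qed.

(** Otherwise the times in [[0, T]] at which [e] is at least [delta ^ 2] form a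
nonempty compact set; at its least element the estimate valid before the exit
puts [e] below [delta ^ 2]. *)
Lemma perturbed_flow_near (t : R) :
  p%:R * eta ^+ 2 * expR ((1 + 2 * p%:R * L) * T) < delta ^+ 2 ->
  0 <= t <= T -> `|v t - u t| < delta.
Proof.
move=> kd tT; rewrite -/k -/c in kd.
suff small : forall s, 0 <= s <= T -> e s < delta ^+ 2.
  rewrite -(@ltr_pXn2r _ 2) ?nnegrE ?normr_ge0 ?ltW//.
  by apply: le_lt_trans (small _ tT); exact: normr_sqr_le_sqnorm.
apply: contrapT => /existsNP[s /not_implyP[sT /negP]]; rewrite -leNgt => es.
pose B := `[0, T] `&` e @^-1` [set y | delta ^+ 2 <= y].
have Bs : B s by split => //; rewrite /= in_itv.
have cB : closed B.
  rewrite /B closed_setSI; last exact: interval_closed.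
  by apply: closed_comp => [y _|]; [exact: within_e|exact: closed_ge].
have kB : compact B.
  by apply: (subclosed_compact cB (@segment_compact _ 0 T)); exact: subIsetl.
have [t1 Bt1 t1min] : exists2 t1, t1 \in B & forall s, s \in B -> t1 <= s.
  apply: (@compact_EVT_min _ _ (fun s : R => s) B) => //; first by exists s.
  by apply: continuous_subspaceT => z; exact: cvg_id.
move: Bt1; rewrite inE => -[]; rewrite /= in_itv /= => t1T; apply/negP.
rewrite -ltNge; apply: le_lt_trans kd; apply: deviation_le_before_exit => // r.
move=> /andP[r0 rt1]; rewrite ltNge; apply/negP => er.
have /t1min : r \in B.
  rewrite inE; split => //=; rewrite in_itv /= (ltW r0) (le_trans (ltW rt1))//.
  by case/andP: t1T.
by rewrite leNgt rt1.
Qed.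

End perturbed_flow.

(** * Convergence of the trajectories *)

Section assembly.
Context (R : realType) (p : nat).
Implicit Types (P : probability 'rV[R]_p R) (f : 'rV[R]_p -> R) (x : 'rV[R]_p).

Lemma Ck_leS n f : Ck n.+1 f -> Ck n f.
Proof.
elim: n f => [|n IH] f [cf df]; first by split.
by split => // i; have [? ?] := df i; split => //; exact: IH.
Qed.

(** A single constant serves as bound and as Lipschitz constant for [f] and all
its partial derivatives, which spares the final estimate several constants. *)
Lemma C2_ball_bounds f (r : R) : Ck 2 f -> exists2 K, 0 <= K &
  [/\ forall y, `|y| <= r -> `|f y| <= K,
      forall i y, `|y| <= r -> `|partial f i y| <= K,
      forall y w, `|y| <= r -> `|w| <= r -> `|f w - f y| <= K * `|w - y| &
      forall i y w, `|y| <= r -> `|w| <= r ->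
        `|partial f i w - partial f i y| <= K * `|w - y|].
Proof.
move=> C2f; have [cf dC1f] := C2f.
have [M M0 fM] := continuous_bounded_ball r cf.
have [L L0 fL] := C1_lipschitz_ball r (Ck_leS C2f).
have /choice[N NP] i : exists N, 0 <= N /\
    forall y, `|y| <= r -> `|partial f i y| <= N.
  by have [N N0 dfN] := continuous_bounded_ball r (dC1f i).2.1; exists N.
have /choice[Q QP] i : exists Q, 0 <= Q /\ forall y w, `|y| <= r -> `|w| <= r ->
    `|partial f i w - partial f i y| <= Q * `|w - y|.
  by have [Q Q0 dfQ] := C1_lipschitz_ball r (dC1f i).2; exists Q.
pose K := M + L + \sum_i (N i + Q i).
have NQ0 i : 0 <= N i + Q i by rewrite addr_ge0 ?(NP i).1 ?(QP i).1.
have S0 : 0 <= \sum_i (N i + Q i) by apply: sumr_ge0 => i _.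
have NQK i : N i + Q i <= K.
  rewrite /K (bigD1 i)//= addrCA lerDl !addr_ge0//.
  by apply: sumr_ge0 => j _.
have NK i : N i <= K by rewrite (le_trans _ (NQK i))// lerDl (QP i).1.
have QK i : Q i <= K by rewrite (le_trans _ (NQK i))// lerDr (NP i).1.
have MK : M <= K by rewrite /K -addrA lerDl addr_ge0.
have LK : L <= K by rewrite /K addrAC lerDr addr_ge0.
exists K; first exact: le_trans MK.
split => [y yr|i y yr|y w yr wr|i y w yr wr].
- exact: le_trans (fM _ yr) MK.
- exact: le_trans ((NP i).2 _ yr) (NK i).
- by rewrite (le_trans (fL _ _ yr wr))// ler_wpM2r.
- by rewrite (le_trans ((QP i).2 _ _ yr wr))// ler_wpM2r.
Qed.

Lemma fine_Lambda1_gt0 P (tau : R) x : pos_set (f_tau P tau) x ->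
  0 < fine (Lambda1 R p).
Proof.
rewrite /pos_set /= /f_tau => fpos; rewrite lt0r; apply/andP; split.
  apply: contraTneq fpos => ->.
  by rewrite sqrtr0 mulr0 invr0 mul0r ltxx.
by rewrite fine_ge0.
Qed.

End assembly.

Unset Implicit Arguments.
Set Strict Implicit.

Theorem theorem3p2 (R : realType) (p : nat) (hp : (1 <= p)%N)
    (P : probability 'rV[R]_p R) (f : 'rV[R]_p -> R)
    (hac : P `<< lebesgue_rV R p) (hf : is_density P f) (hC2 : Ck 2 f)
    (hcomp : forall alpha : R, 0 < alpha ->
       compact [set x : 'rV[R]_p | alpha <= f x])
    (u : 'rV[R]_p -> R -> 'rV[R]_p)
    (hu : forall x, pos_set f x -> gradient_solution f (pos_set f) x (u x))
    (u_tau : 'rV[R]_p -> R -> R -> 'rV[R]_p)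
    (hu_ : forall x tau, pos_set f x -> 0 < tau ->
       gradient_solution (f_tau P tau) (pos_set (f_tau P tau)) x (u_tau x tau)) :
  forall (t : R) (x : 'rV[R]_p), 0 <= t -> pos_set f x ->
    u_tau x tau t @[tau --> 0^'+] --> u x t.
Proof.
move=> T x T0 Sx.
have [ux0 uS cu du] := hu x Sx.
have L10 : 0 < fine (Lambda1 R p).
  have [_ /(_ 0 (lexx _)) + _ _] := hu_ x 1 Sx ltr01.
  exact: fine_Lambda1_gt0.
have cuT : {within `[0, T], continuous (u x)}.
  exact: (continuous_subspaceW (@subset_itvl _ R (BLeft 0) (BRight T) +oo%O isT) cu).
have [r ur] : exists r, forall s, 0 <= s <= T -> `|u x s| <= r.
  have [|s _ smax] := @EVT_max R (fun s => `|u x s|) 0 T T0.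
    by move=> s; exact: (continuous_comp (cuT s) (@norm_continuous _ _ _)).
  by exists `|u x s| => s' s'T; apply: smax; rewrite in_itv.
have [m m0 fm] : exists2 m, 0 < m & forall s, 0 <= s <= T -> 2 * m <= f (u x s).
  have [|s] := @EVT_min R (fun s => f (u x s)) 0 T T0.
    by move=> s; exact: (continuous_comp (cuT s) (hC2.1 _)).
  rewrite in_itv /= => /andP[s0 sT] smin; exists (f (u x s) / 2).
    by rewrite divr_gt0//; exact: uS.
  by move=> s' s'T; rewrite mulrC divfK//; apply: smin; rewrite in_itv.
have [K K0 [fK dfK fL dfL]] := C2_ball_bounds (r + 1 + 1) hC2.
apply/cvgrPdist_le => eps eps0.
(* The tube has radius at most [eps], as required of the conclusion; at most 1, so
   that it lies in the ball; and at most [m / (K + 1)], so that [f >= m] on it. *)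
pose delta := Num.min eps (Num.min 1 (m / (K + 1))).
have K1 : 0 < K + 1 by rewrite ltr_wpDl.
have d0 : 0 < delta by rewrite !lt_min eps0 ltr01 divr_gt0.
have d1 : delta <= 1 by rewrite !ge_min lexx orbT.
have dm : K * delta <= m.
  have : delta <= m / (K + 1) by rewrite !ge_min lexx !orbT.
  rewrite ler_pdivlMr//; nra.
(* The gradients differ by at most [C tau] on the tube. *)
pose C := (4 * K * K + 4 * K ^+ 2 * K / m) / m.
have C0 : 0 <= C.
  have K2 : 0 <= 4 * K * K by rewrite !mulr_ge0.
  have K3 : 0 <= 4 * K ^+ 2 * K / m by rewrite !mulr_ge0 ?invr_ge0 ?sqr_ge0 ?(ltW m0).
  by rewrite /C mulr_ge0 ?addr_ge0 ?invr_ge0 ?(ltW m0).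
pose E := p%:R * expR ((1 + 2 * p%:R * K) * T).
have E0 : 0 <= E by rewrite mulr_ge0// expR_ge0.
have q0 : 0 < C * (E + 1) + 1 by rewrite ltr_wpDl// mulr_ge0// addr_ge0.
(* The three bounds give: arguments of [f] in the ball of radius [r + 2], the
   smallness condition for the gradient estimate, and a deviation below
   [delta]. *)
pose tau0 := Num.min 1 (Num.min (m ^+ 2 / (4 * K * K + 1)) (delta / (C * (E + 1) + 1))).
have K40 : 0 <= 4 * K * K by rewrite !mulr_ge0.
have K41 : 0 < 4 * K * K + 1 by rewrite ltr_wpDl.
have tau00 : 0 < tau0 by rewrite !lt_min ltr01 !divr_gt0// exprn_gt0.
near=> tau.
have t0 : 0 < tau by near: tau; exact: nbhs_right_gt.
have tt0 : tau < tau0 by near: tau; exact: nbhs_right_lt.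
have [t1 tm td] : [/\ tau <= 1, 4 * K * K * tau <= m ^+ 2 & (C * (E + 1) + 1) * tau < delta].
  move: tt0; rewrite lt_min => /andP[a]; rewrite lt_min => /andP[].
  rewrite !ltr_pdivlMr// => b c; split; [exact: ltW| |by rewrite mulrC].
  by nra.
have [vx0 _ cv dv] := hu_ x tau Sx t0.
rewrite distrC; apply: (@le_trans _ _ delta); last by rewrite ge_min lexx.
apply/ltW; apply: (@perturbed_flow_near R p (grad f) (grad (f_tau P tau))
  (u x) (u_tau x tau) T delta (C * tau) K) => //.
- by rewrite ux0 vx0.
- move=> s w sT ws i; rewrite !mxE.
  have us := ur _ sT.
  have wr : `|w| <= r + 1.
    rewrite -(subrK (u x s) w) addrC (le_trans (ler_normD _ _))// lerD//.
    exact: le_trans (ltW ws) d1.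
  have wr1 : `|w| <= r + 1 + 1 by rewrite (le_trans wr)// lerDl.
  have us1 : `|u x s| <= r + 1 + 1 by rewrite (le_trans us)// -addrA lerDl.
  have mfw : m <= f w.
    have := fL _ _ us1 wr1; rewrite ler_distl => /andP[+ _].
    have := fm _ sT.
    have : K * `|w - u x s| <= m by rewrite (le_trans _ dm)// ler_wpM2l// ltW.
    lra.
  rewrite -(subrKA (partial f i w)) (le_trans (ler_normD _ _))// lerD//.
    apply: (@partial_f_tau_near R p P f (r + 1) K K m tau w i) => //.
    - exact: Ck_leS.
    - exact: dfK.
    - exact: dfL.
  exact: dfL.
(* [E (C tau) ^ 2 <= ((E + 1) C tau) ^ 2 < delta ^ 2]. *)
- rewrite (_ : _ * _ = E * (C * tau) ^+ 2); last by rewrite /E; ring.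
  have Ct0 : 0 <= C * tau by rewrite mulr_ge0// ltW.
  have ctd : (E + 1) * (C * tau) < delta.
    by apply: lt_trans td; rewrite [ltRHS]mulrDl mul1r mulrA [(E + 1) * C]mulrC ltrDl.
  have : ((E + 1) * (C * tau)) ^+ 2 < delta ^+ 2.
    have A0 : 0 <= (E + 1) * (C * tau) by rewrite mulr_ge0// addr_ge0.
    by rewrite ltr_pXn2r// nnegrE// ltW.
  apply: le_lt_trans; rewrite [leRHS]exprMn ler_wpM2r ?sqr_ge0//; nra.
- by rewrite T0 lexx.
Unshelve. all: by end_near.
Qed.
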